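(* Let $X$ be either the group $(\mathbb{R},+)$ or the group $(2^\omega,+_2)$. For every meagre set $F\subseteq X$ there exist an element $x\in X$ and a dense subgroup $H\le X$ without the Baire property such that $(F+x)\cap H=\emptyset$.
   Context: $(2^\omega,+_2)$ is the Cantor space of infinite binary sequences with its product topology and with coordinate-wise addition modulo $2$; $\mathbb{R}$ carries its usual topology. For $A\subseteq X$ and $x\in X$, $A+x=\{a+x : a\in A\}$, where $+$ is the group operation of $X$. A set has the Baire property if it differs from an open set by a meagre set. *)

(* Defs.v *)
From HB Require Import structures.
From mathcomp Require Import all_boot all_order all_algebra.
From mathcomp Require Import all_classical all_reals all_analysis.
Set Implicit Arguments.
Unset Strict Implicit.
Unset Printing Implicit Defensive.
Import Order.TTheory GRing.Theory Num.Theory.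
Import numFieldNormedType.Exports.

Local Open Scope classical_set_scope.
Local Open Scope ring_scope.

(* The group law on [bool] is [addb], so the pointwise structure on
   [nat -> bool] is coordinate-wise addition modulo 2. *)
HB.instance Definition _ := GRing.Zmodule.copy cantor_space (nat -> bool).

Lemma cantor_addE (x y : cantor_space) (n : nat) : (x + y) n = x n (+) y n.
Proof. by []. Qed.

Definition nowhere_dense (T : topologicalType) (A : set T) : Prop :=
  (closure A)° = set0.

Definition meagre (T : topologicalType) (A : set T) : Prop :=
  exists2 B : (set T)^nat, forall n, nowhere_dense (B n) & A = \bigcup_n B n.

Definition baire_property (T : topologicalType) (A : set T) : Prop :=
  exists2 U : set T, open U & meagre (A `+` U).

Definition is_subgroup (V : zmodType) (H : set V) : Prop :=
  GRing.zmod_closed [in H].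

(* Main.v *)
Require Import Defs.
From mathcomp Require Import all_boot all_order all_algebra.
From mathcomp Require Import all_classical all_reals all_analysis.
From mathcomp Require Import zify lra.
Import Order.TTheory GRing.Theory Num.Theory.
Import numFieldNormedType.Exports.
Local Open Scope classical_set_scope.
Local Open Scope ring_scope.

(** Both groups are separable, have no isolated point and carry a countable
    base [W] of neighbourhoods of 0 for which they are complete
    ([complete_scale]); the argument takes place in any such group.

    Let [e] be a dense sequence.  Given a nonprincipal ultrafilter [U] on nat
    and a map [m : nat -> nat], the points that for [U]-many [n] lie very close
    (at scale about [m n]) to a bounded combination of [e 0, ..., e (n-1)] form
    a subgroup [filter_group m U].  It has two opposite features.

    It is large for every [m]: it is nonmeagre in every nonempty open set.  To
    escape nowhere dense sets [C i], two points are built simultaneously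
    ([two_chains]), each the limit of a fast sequence of terms of [e].  They
    move in turn: while one moves, the other stays extremely close to an old
    term of [e], so that every large [n] is good for one of the two.  An
    ultrafilter has to accept the good indices of one of them, and that point
    is in the group.

    It is small when [m] grows fast.  Let [F] be the union of nowhere dense
    sets [B i].  All combinations of the [e i] together form a countable set,
    and the group is not meagre in itself, so some [y] satisfies
    [y + s \notin closure (B i)] for all these [s] and all [i].  At stage [n] only finitely many [s] and [i] matter, which allows
    one [m n] to keep the [m n]-neighbourhood of each [y + s] off these [B i].
    Then [y + filter_group m U] misses [F] ([avoiding_subgroup]).

    Density is immediate from nonmeagreness in every open set.  So is the
    failure of the Baire property, once some [z] lies outside the group [H]: if
    [H] differed by a meagre set from an open [V], then either [V] is empty and
    [H] is meagre, or [H] meets the open set [V - z] in a meagre set, because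
    [(H + z) `&` V] is contained in [V `\` H].  Adding [[set 0]] to the [B i]
    provides such a [z], namely [- y]. *)

(** * Meagre sets *)

Lemma meagre_sub {X : topologicalType} (A B : set X) :
  A `<=` B -> meagre B -> meagre A.
Proof.
move=> AB [C Cnd BC]; exists (fun n => C n `&` A).
  move=> n; apply/seteqP; split=> // x Cx; rewrite -(Cnd n).
  by apply: interiorS Cx; apply: closureS => y [].
rewrite -setI_bigcupl -BC; apply/seteqP; split=> [x Ax|x []//].
by split=> //; exact: AB.
Qed.

Lemma meagre_countable_union {X : topologicalType} (I : countType)
    (B : I -> set X) :
  (forall i, nowhere_dense (B i)) -> meagre (\bigcup_i B i).
Proof.
move=> Bnd; exists (fun n => if unpickle n is Some i then B i else set0).
  move=> n; case: unpickle => [i|]; first exact: Bnd.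
  by rewrite /nowhere_dense closure0 interior0.
apply/seteqP; split=> [x [i _ Bx]|x [n _]].
  by exists (pickle i) => //; rewrite pickleK.
by case: unpickle => // i Bx; exists i.
Qed.

(** * Groups with a complete scale of neighbourhoods of 0 *)

(** The sets [W m] play the role of closed balls of radius [2 ^- m] for a
    complete invariant metric.  Completeness is stated for the only sequences
    that occur, and puts the limit inside every ball that contains a tail, as
    holds for closed balls. *)
Record complete_scale {X : PreTopologicalZmodule.type} (W : nat -> set X) :
    Prop := CompleteScale {
  scale0 : forall m, W m 0;
  scaleN : forall m u, W m u -> W m (- u);
  scaleD : forall m u v, W m.+1 u -> W m.+1 v -> W m (u + v);
  scale_nbhs : forall (x : X) (A : set X),
    nbhs x A <-> exists m, forall w, W m w -> A (x + w);
  scale_complete : forall (a : nat -> X) (K : nat -> nat),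
    (forall i, (K i < K i.+1)%N) ->
    (forall i j, (i <= j)%N -> W (K i) (a j - a i)) ->
    exists x, forall i, W (K i) (x - a i);
  scale_nondiscrete : forall m, exists2 w, W m w & exists k, ~ W k w
}.

Section Scale.
Context {X : PreTopologicalZmodule.type} {W : nat -> set X}.
Hypothesis scaleW : complete_scale W.

Lemma scaleB m u v : W m.+1 u -> W m.+1 v -> W m (u - v).
Proof.
by move=> Wu Wv; apply: (scaleD _ scaleW) => //; apply: (scaleN _ scaleW).
Qed.

Lemma scale_anti m n u : (m <= n)%N -> W n u -> W m u.
Proof.
move=> /subnK <-; elim: (n - m)%N => [//|k IHk] Wu; apply: IHk.
by rewrite -[u]addr0; apply: (scaleD _ scaleW) => //; exact: (scale0 _ scaleW).
Qed.

(** In this form the notion is visibly invariant under translations, and it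
    provides the moves of the constructions below. *)
Lemma nowhere_denseP (A : set X) :
  nowhere_dense A <-> forall x m, exists y k,
    W m (y - x) /\ forall w, W k w -> ~ A (y + w).
Proof.
split=> [And x m|Asep].
  apply: contrapT => nosep; suff : (closure A)° x by rewrite And.
  apply/(scale_nbhs _ scaleW); exists m => u Wu B /(scale_nbhs _ scaleW)[k WkB].
  apply: contrapT => AB0; apply: nosep; exists (x + u), k.
  rewrite addrAC subrr add0r; split=> // w Wkw Aw; apply: AB0.
  by exists (x + u + w); split=> //; exact: WkB.
apply/seteqP; split=> // x /(scale_nbhs _ scaleW)[m Wcl].
have [y [k [Wy noA]]] := Asep x m.
have := Wcl _ Wy; rewrite addrC subrK => /(_ [set z | W k (z - y)])[].
  by apply/(scale_nbhs _ scaleW); exists k => w; rewrite /= addrAC subrr add0r.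
by move=> z [Az /noA]; rewrite addrC subrK.
Qed.

Lemma nowhere_dense_shift (A : set X) v :
  nowhere_dense A -> nowhere_dense [set x | A (x + v)].
Proof.
move=> /nowhere_denseP Asep; apply/nowhere_denseP => x m.
have [y [k [Wy noA]]] := Asep (x + v) m.
exists (y - v), k; rewrite -addrA -opprD (addrC v); split=> // w /noA.
by rewrite /= addrAC subrK.
Qed.

Lemma meagre_shift (A : set X) v : meagre A -> meagre [set x | A (x + v)].
Proof.
case=> B Bnd ->; exists (fun n => [set x | B n (x + v)]) => // n.
exact: nowhere_dense_shift.
Qed.

(** Either [z] cannot be separated from [x], and then a point of the ball around
    [z] that is not infinitely close to [z] is separated from [x], or [z] itself
    is separated from [x]. *)
Lemma nowhere_dense_set1 (x : X) : nowhere_dense [set x].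
Proof.
apply/nowhere_denseP => z m.
have [w Ww [k Wkw]] := scale_nondiscrete _ scaleW m.
have [zx|zx] := pselect (forall j, W j (x - z)).
  exists (z + w), k.+1; rewrite addrAC subrr add0r; split=> // u Wu zwux.
  apply: Wkw; have -> : w = (x - z) - u.
    by rewrite -zwux addrAC addrK addrAC subrr add0r.
  by apply: scaleB.
have /existsNP[j Wj] := zx.
exists z, j; rewrite subrr; split=> [|u Wu zux]; first exact: (scale0 _ scaleW).
by apply: Wj; rewrite -zux addrAC subrr add0r.
Qed.

(** The geometric series: the steps of a sequence add up to at most twice the
    first one. *)
Lemma chain_limit (b : nat -> X) (K : nat -> nat) :
  (forall i, (K i < K i.+1)%N) ->
  (forall i, W (K i).+1 (b i.+1 - b i)) ->
  exists x, forall i, W (K i) (x - b i).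
Proof.
move=> Kincr bW; apply: (scale_complete _ scaleW) => // i j /subnK <-.
move: (j - i)%N => k; elim: k i => [|k IHk] i; first by rewrite subrr; exact: (scale0 _ scaleW).
have -> : b (k.+1 + i)%N - b i = (b (k + i.+1)%N - b i.+1) + (b i.+1 - b i).
  by rewrite addrA subrK addnS.
by apply: (scaleD _ scaleW) => //; apply: scale_anti (IHk _).
Qed.

(** * Two points moving in turn *)

Variable e : nat -> X.
Hypothesis e_dense : forall x m, exists c, W m (e c - x).

Lemma avoid_step (A : set X) c m N : nowhere_dense A ->
  exists p : nat * nat, [/\ W m (e p.1 - e c), (N < p.2)%N, (p.1 < p.2)%N &
    forall w, W p.2 w -> ~ A (e p.1 + w)].
Proof.
move=> /nowhere_denseP Asep; have [y [k [Wy noA]]] := Asep (e c) m.+1.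
have [c' Wc'] := e_dense y (maxn m.+1 k.+1).
exists (c', (k.+1 + N.+1 + c'.+1)%N); split=> /=; try by lia.
  rewrite -(subrK y (e c')) -addrA; apply: (scaleD _ scaleW) => //.
  by apply: scale_anti Wc'; rewrite leq_maxl.
move=> w Ww; rewrite -(subrK y (e c')) addrAC addrC; apply: noA.
apply: (scaleD _ scaleW); first by apply: scale_anti Wc'; rewrite leq_maxr.
by apply: scale_anti Ww; lia.
Qed.

(** The next term [c j.+2] is chosen near [c j], at the scale [g (N j)], so
    the even and the odd terms form two separate chains with limits [x false]
    and [x true].  The limit through [c j.+1] stays within [W (g (N j.+1))] of
    [e (c j.+1)], and [c j.+1 < N j]; this makes it good for all
    [n] in the interval from [N j] to [N j.+1].  The chains own these intervals
    alternately. *)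
Lemma two_chains (M : nat -> nat) (C : nat -> set X) x0 m0 :
  (forall i, nowhere_dense (C i)) ->
  exists x : bool -> X, [/\ forall q, W m0 (x q - x0),
    forall q i, ~ C i (x q) &
    exists n0, forall n, (n0 <= n)%N ->
      exists q, exists2 c, (c < n)%N & W (M n) (x q - e c)].
Proof.
move=> Cnd.
(* [g] is strictly increasing and bounds both [M] and the identity. *)
pose g n := (n + \sum_(i < n.+1) M i)%N.
have g_lt m n : (m < n)%N -> (g m < g n)%N.
  move=> mn; rewrite /g -addSn; apply: leq_add => //.
  rewrite -2!(big_mkord xpredT (fun i => M i)).
  rewrite [leqRHS](big_cat_nat (leq0n m.+1)) /=; first exact: leq_addr.
  exact: leqW.
have gM n k : (n <= k)%N -> (M n <= g k)%N.
  move=> nk; rewrite /g (bigD1 (Ordinal (nk : n < k.+1)%N)) //= addnCA.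
  exact: leq_addr.
have g_ge n : (n <= g n)%N by rewrite leq_addr.
(* [a] holds the stage, the last term of the chain that moves, and [N]; a chain
   moves at every second stage, and halving the stage lets both chains escape
   every [C i]. *)
have step (a : nat * nat * nat) : exists p : nat * nat,
    [/\ W (g a.2).+1 (e p.1 - e a.1.2), (a.2 < p.2)%N, (p.1 < p.2)%N &
    forall w, W p.2 w -> ~ C a.1.1./2 (e p.1 + w)].
  exact: avoid_step.
have [f fP] := choice step.
have [c0 Wc0] := e_dense x0 m0.+1.
pose N0 := (c0 + m0).+1.
(* The state [(c, d, N)] lists the last terms of the two chains, the one that
   moves next in front.  Both chains start at [c0]. *)
pose st := fix st j := if j is j'.+1 then
  let: (c, d, N) := st j' in let p := f (j', c, N) in (d, p.1, p.2)
  else (c0, c0, N0).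
pose c j := (st j).1.1; pose N j := (st j).2.
have stE j : (c j.+2, N j.+1) = f (j, c j, N j).
  by rewrite /c /N /=; case: (st j) => [[? ?] ?] /=; case: (f _).
have Wc j : W (g (N j)).+1 (e (c j.+2) - e (c j)).
  by have [] := fP (j, c j, N j); rewrite -stE.
have Nincr j : (N j < N j.+1)%N.
  by have [] := fP (j, c j, N j); rewrite -stE.
have cN j : (c j.+1 < N j)%N.
  case: j => [|j]; first by rewrite /c /N /= /N0 ltnS leq_addr.
  by have [] := fP (j, c j, N j); rewrite -stE.
have avoidC j w : W (N j.+1) w -> ~ C j./2 (e (c j.+2) + w).
  by have [_ _ _] := fP (j, c j, N j); rewrite -stE; apply.
have limit (q : bool) : exists x,
    forall i, W (g (N (q + i.*2)%N)) (x - e (c (q + i.*2)%N)).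
  apply: (chain_limit (fun i => e (c (q + i.*2)%N))
                      (fun i => g (N (q + i.*2)%N))) => i.
    by rewrite doubleS !addnS; apply/g_lt/(ltn_trans (Nincr _)).
  by rewrite doubleS !addnS; exact: Wc.
have [x xP] := choice limit.
have NN0 j : (N0 <= N j)%N.
  by elim: j => // j IHj; apply: leq_trans IHj (ltnW _).
exists x; split.
- move=> q; have -> : x q - x0 = (x q - e (c q)) + (e c0 - x0).
    by rewrite (_ : c q = c0) ?addrA ?subrK //; case: (q).
  apply: (scaleD _ scaleW) => //; have := xP q 0%N; rewrite addn0.
  apply: scale_anti; apply: leq_trans (g_ge _); apply: leq_trans (NN0 _).
  by rewrite ltnS leq_addl.
- move=> q i; have := xP q i.+1; rewrite doubleS !addnS => xq.
  have := avoidC (q + i.*2)%N (x q - e (c (q + i.*2).+2)).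
  rewrite half_bit_double [e _ + _]addrC subrK; apply.
  by apply: scale_anti xq; apply: leq_trans (g_ge _); exact: ltnW.
- exists N0 => n N0n.
  have [j /andP[Njn nNj]] : exists j, (N j <= n < N j.+1)%N.
    have Nj j : (j <= N j)%N by elim: j => // j /leq_ltn_trans; apply.
    have exj : exists j, (N j <= n)%N by exists 0%N.
    have ubj j : (N j <= n -> j <= n)%N by apply: leq_trans.
    case: (ex_maxnP exj ubj) => j Njn jmax; exists j; rewrite Njn ltnNge.
    by apply/negP => /jmax; rewrite ltnn.
  exists (odd j.+1); exists (c j.+1); first exact: leq_trans (cN j) Njn.
  have := xP (odd j.+1) j.+1./2; rewrite odd_double_half.
  by apply: scale_anti; apply: gM; exact: ltnW.
Qed.

(** * The group attached to an ultrafilter *)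

Fixpoint differences (l : seq X) k : seq X :=
  if k is k'.+1 then
    [seq a - b | a <- differences l k', b <- differences l k'] else l.

Lemma differences_mono l k k' : 0 \in l -> (k <= k')%N ->
  {subset differences l k <= differences l k'}.
Proof.
move=> l0 /subnK <-; have z j : 0 \in differences l j.
  by elim: j => //= j IHj; rewrite -(subr0 0); apply/allpairsP; exists (0, 0).
elim: (k' - k)%N => // j IHj s /IHj sj /=; rewrite -(subr0 s).
by apply/allpairsP; exists (s, 0).
Qed.

Definition centers n : seq X := 0 :: [seq e i | i <- iota 0 n].

Definition near_seq (l : seq X) m : set X :=
  [set x | exists2 s, s \in l & W m (x - s)].

(** Subtracting two points costs one level of [differences] and one unit of
    precision, so any fixed number of operations is affordable at all large [n].
    The bonus [n - k] leaves precision [m n] even at the level [k = n]. *)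
Definition filter_group (m : nat -> nat) (U : set_system nat) : set X :=
  [set x | exists k, \forall n \near U,
     near_seq (differences (centers n) k) (m n + (n - k)) x].

Section FilterGroup.
Variables (m : nat -> nat) (U : set_system nat).
Context {ultraU : UltraFilter U}.
Hypothesis ooU : \oo `<=` U.

Let largeU k : \forall n \near U, (k <= n)%N.
Proof. by apply: ooU; exists k. Qed.

Lemma near_seq_mono n k k' : (k <= k')%N ->
  near_seq (differences (centers n) k) (m n + (n - k)) `<=`
  near_seq (differences (centers n) k') (m n + (n - k')).
Proof.
move=> kk' x [s ls Wx]; exists s.
  by apply: differences_mono ls; rewrite ?mem_head.
by apply: scale_anti Wx; rewrite leq_add2l leq_sub2l.
Qed.

Lemma filter_group_subgroup : is_subgroup (filter_group m U).
Proof.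
split=> [|x y]; rewrite !inE.
  exists 0%N; apply: nearW => n; exists 0; first exact: mem_head.
  by rewrite subrr; exact: (scale0 _ scaleW).
move=> [k xk] [k' yk']; pose K := maxn k k'.
exists K.+1; apply: filterS3 (largeU K.+1) xk yk' => n Kn.
move=> /(near_seq_mono _ _ K (leq_maxl _ _))[s ls Ws].
move=> /(near_seq_mono _ _ K (leq_maxr _ _))[t lt Wt].
exists (s - t); first by apply/allpairsP; exists (s, t).
have -> : x - y - (s - t) = (x - s) - (y - t) by rewrite !opprD !opprK addrACA.
by apply: scaleB; rewrite -addnS -subSn.
Qed.

(** Level [k = 0] of the definition suffices for one of the two points. *)
Lemma filter_group_nonmeagre (V : set X) : open V -> V !=set0 ->
  ~ meagre (filter_group m U `&` V).
Proof.
move=> oV [x0 Vx0] [C Cnd HVC].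
have /(scale_nbhs _ scaleW)[m0 WV] : nbhs x0 V by exact: open_nbhs_nbhs.
have [x [xV xC [n0 cover]]] := two_chains (fun n => m n + (n - 0))%N C x0 m0 Cnd.
pose good q := [set n | near_seq (centers n) (m n + (n - 0)) (x q)].
suff [q Uq] : exists q, U (good q).
  have : (filter_group m U `&` V) (x q).
    by split; [exists 0%N|rewrite -(subrK x0 (x q)) addrC; exact: WV].
  by rewrite HVC => -[i _ /xC].
have [Ut|Uf] := in_ultra_setVsetC (good true) ultraU; first by exists true.
exists false; apply: filterS2 (largeU n0) Uf => n /cover[q [c cn Wx]] /= ntrue.
have : good q n.
  by exists (e c) => //; rewrite inE map_f ?orbT // mem_iota.
by case: q {Wx}.
Qed.

Lemma filter_group_dense : dense (filter_group m U).
Proof.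
move=> V V0 oV; have nm := filter_group_nonmeagre _ oV V0.
apply: contrapT => HV; apply: nm; exists (fun=> set0).
  by move=> _; rewrite /nowhere_dense closure0 interior0.
rewrite bigcup0// setIC; apply/seteqP; split=> // x Hx.
by apply: HV; exists x.
Qed.

(** [H] cannot be comeagre in an open set [V]: the translate of [H] by
    [z] is disjoint from [H], yet nonmeagre in [V]. *)
Lemma filter_group_no_baire z : ~ filter_group m U z ->
  ~ baire_property (filter_group m U).
Proof.
set H := filter_group m U => nHz [V oV HV].
have [V0|/set0P[v Vv]] := eqVneq V set0.
  apply: (filter_group_nonmeagre setT openT); first by exists 0.
  by apply: meagre_sub HV => x [Hx _]; rewrite V0; left; split.
have oVz : open [set x | V (x + z)].
  rewrite openE => x Vx; have : nbhs (x + z) V by exact: open_nbhs_nbhs.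
  move=> /(scale_nbhs _ scaleW)[k WV]; apply/(scale_nbhs _ scaleW).
  by exists k => w /WV; rewrite /= addrAC.
apply: (filter_group_nonmeagre _ oVz); first by exists (v - z); rewrite /= subrK.
apply: meagre_sub (meagre_shift _ z HV) => x [Hx Vx]; right; split=> // Hxz.
apply: nHz; have [_ HB] := filter_group_subgroup.
have -> : z = (x + z) - x by rewrite addrAC subrr add0r.
by have := HB (x + z) x; rewrite !inE; apply.
Qed.

End FilterGroup.

(** * A translate of the group that avoids a meagre set *)

Lemma uniform_separation (l : seq X) (A : set X) :
  (forall s, s \in l -> ~ closure A s) ->
  exists k, forall s w, s \in l -> W k w -> ~ A (s + w).
Proof.
elim: l => [|s l IHl] sepA; first by exists 0%N.
have [k lk] := IHl (fun t lt => sepA t (@mem_behead _ (s :: l) _ lt)).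
have /existsNP[B /not_implyP[/(scale_nbhs _ scaleW)[j WB] BA0]] :=
  sepA s (mem_head _ _).
exists (maxn k j) => t w; rewrite inE => /predU1P[->|lt] Ww Aw.
  apply: BA0; exists (s + w); split=> //; apply: WB.
  by apply: scale_anti Ww; rewrite leq_maxr.
by apply: lk lt _ Aw; apply: scale_anti Ww; rewrite leq_maxl.
Qed.

Lemma uniform_family_separation (l : seq X) (B : nat -> set X) n :
  (forall i s, s \in l -> ~ closure (B i) s) ->
  exists k, forall i s w, (i < n)%N -> s \in l -> W k w -> ~ B i (s + w).
Proof.
move=> sepB; elim: n => [|n [k sepk]]; first by exists 0%N.
have [j sepj] := uniform_separation l (B n) (sepB n).
exists (maxn k j) => i s w; rewrite ltnS leq_eqVlt => /predU1P[->|ltin] ls Ww.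
  by apply: sepj => //; apply: scale_anti Ww; rewrite leq_maxr.
by apply: sepk => //; apply: scale_anti Ww; rewrite leq_maxl.
Qed.

Lemma avoiding_subgroup (F : set X) : meagre F ->
  exists (x : X) (H : set X),
    [/\ is_subgroup H, dense H, ~ baire_property H
      & [set a + x | a in F] `&` H = set0].
Proof.
(* The extra set [[set 0]] puts [- y] outside the group. *)
move=> [B0 B0nd ->]; pose B i := if i is i'.+1 then B0 i' else [set 0].
have Bnd i : nowhere_dense (closure (B i)).
  have : nowhere_dense (B i) by case: i => //=; exact: nowhere_dense_set1.
  rewrite /nowhere_dense -(closure_id (closure (B i))).1 //.
  exact: closed_closure.
have [U [ultraU ooU]] := @ultraFilterLemma nat \oo _.
pose E n := differences (centers n) n.
have [y yB] : exists y, forall i n s, s \in E n -> ~ closure (B i) (y + s).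
  pose Z (p : nat * nat * nat) : set X :=
    [set y | closure (B p.1.1) (y + nth 0 (E p.1.2) p.2)].
  have mZ : meagre (\bigcup_p Z p).
    by apply: meagre_countable_union => p; exact: nowhere_dense_shift.
  (* [X] is not meagre because it contains a nonmeagre group. *)
  apply: contrapT => noy.
  apply: (@filter_group_nonmeagre (fun=> 0%N) U _ ooU setT openT).
    by exists 0.
  apply: meagre_sub mZ => y _; apply: contrapT => yZ; apply: noy.
  exists y => i n s sE Bys; apply: yZ; exists (i, n, index s (E n)) => //.
  by rewrite /Z /= nth_index.
have /choice[m mP] : forall n, exists k, forall i s w,
    (i < n.+1)%N -> s \in [seq y + s | s <- E n] -> W k w -> ~ B i (s + w).
  move=> n; apply: uniform_family_separation => i _ /mapP[s sE ->].
  exact: yB sE.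
have avoidH i h : filter_group m U h -> ~ B i (y + h).
  move=> [k hk].
  have [n [kn]] := filter_ex (filterI hk (ooU _ (nbhs_infty_ge (maxn k i)))).
  rewrite /= geq_max => /andP[nk ni].
  have [s sE Ws] := near_seq_mono m n k n nk _ kn.
  rewrite -(subrK s h) [h - s + s]addrC addrA; apply: (mP n) => //.
    by rewrite map_f.
  by apply: scale_anti Ws; rewrite leq_addr.
exists (- y), (filter_group m U); split.
- exact: filter_group_subgroup.
- exact: filter_group_dense.
- apply: (@filter_group_no_baire m U _ ooU (- y)) => /(avoidH 0%N); apply.
  by rewrite subrr.
- apply/seteqP; split=> // _ [[f [i _ Bf] <-] /(avoidH i.+1)]; apply.
  by rewrite addrC subrK.
Qed.

End Scale.

(** * The real line *)

Lemma real_scale (R : realType) :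
  complete_scale (fun m => [set x : R | `|x| <= 2^-1 ^+ m]).
Proof.
have r0 m : 0 < 2^-1 ^+ m :> R by rewrite exprn_gt0 ?invr_gt0.
split=> /=.
- by move=> m; rewrite normr0 ltW.
- by move=> m u; rewrite normrN.
- move=> m u v; rewrite !exprS => Wu Wv; apply: le_trans (ler_normD _ _) _; lra.
- move=> x A; split=> [/nbhs_ballP[eps /= eps0 epsA]|[m WA]].
    have [m _ /(_ m (leqnn m))] := near_infty_natSinv_expn_lt (PosNum eps0).
    rewrite /= div1r -exprVn => meps; exists m => w Ww; apply: epsA.
    by rewrite /ball /= opprD addrA subrr sub0r normrN; apply: le_lt_trans meps.
  apply/nbhs_ballP; exists (2^-1 ^+ m) => //= z; rewrite /ball /= => xz.
  by rewrite -(subrK x z) addrC; apply: WA; rewrite distrC ltW.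
(* The balls around the [a i] pairwise meet, so the supremum of their left ends
   lies in all of them. *)
- move=> a K _ aK; pose S := range (fun i => a i - 2^-1 ^+ K i).
  have ubS j : ubound S (a j + 2^-1 ^+ K j).
    move=> _ [i _ <-]; have := r0 (K i); have := r0 (K j).
    by case: (leqP i j) => [|/ltnW] /aK; rewrite ler_norml => /andP[]; lra.
  have S0 : S !=set0 by exists (a 0%N - 2^-1 ^+ K 0%N), 0%N.
  exists (sup S) => i; rewrite ler_distl; apply/andP; split.
    by apply: sup_upper_bound; [split=> //; exists (a 0%N + 2^-1 ^+ K 0%N)|exists i].
  exact: ge_sup.
- move=> m; exists (2^-1 ^+ m); first by rewrite ger0_norm // ltW.
  exists m.+1; rewrite ger0_norm ?(ltW (r0 m)) // exprS; have := r0 m; lra.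
Qed.

Lemma rat_seq_dense (R : realType) (x : R) m : exists c,
  `|ratr (odflt 0 (unpickle c)) - x| <= 2^-1 ^+ m.
Proof.
have r0 : 0 < 2^-1 ^+ m :> R by rewrite exprn_gt0 ?invr_gt0.
have [|q] := @rat_in_itvoo R x (x + 2^-1 ^+ m); first by rewrite ltrDl.
rewrite in_itv /= => /andP[xq qx]; exists (pickle q); rewrite pickleK /=.
by rewrite ler_distl; apply/andP; split; lra.
Qed.

(** * The Cantor space *)

Lemma cantor_nbhsP (x : cantor_space) (A : set cantor_space) :
  nbhs x A <-> exists m, forall y : cantor_space,
    (forall i, (i < m)%N -> y i = x i) -> A y.
Proof.
split=> [|[m mA]]; last first.
  have xm : \forall y \near x, forall i : 'I_m, (y : cantor_space) i = x i.
    apply: (@filter_forall _ _ (fun (i : 'I_m) (y : cantor_space) => y i = x i)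
      (nbhs x) (nbhs_filter x)) => i.
    apply: (@proj_continuous _ (fun=> bool) (i : nat) x [set x i]).
    exact: discrete_set1.
  by apply: filterS xm => y yx; apply: mA => i im; exact: (yx (Ordinal im)).
pose G : set_system cantor_space := [set A | exists m, forall y : cantor_space,
  (forall i, (i < m)%N -> y i = x i) -> A y].
have GF : Filter G.
  split=> [|P Q [m mP] [n nQ]|P Q PQ [m mP]].
  - by exists 0%N.
  - exists (maxn m n) => y yx; split; [apply: mP|apply: nQ] => i ilt;
    by apply: yx; rewrite leq_max ilt ?orbT.
  - by exists m => y /mP /PQ.
suff /(_ A) : {ptws, G --> x} by [].
apply/pointwise_cvgP => t B /nbhs_singleton Bx; exists t.+1 => y yx /=.
by rewrite yx.
Qed.

Lemma cantor_scale : complete_scale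
  (fun m => [set x : cantor_space | forall i, (i < m)%N -> x i = false]).
Proof.
split=> /=.
- by [].
- by [].
- by move=> m u v Wu Wv i im; rewrite cantor_addE Wu ?Wv // ltnW.
- move=> x A; rewrite cantor_nbhsP; split=> -[m mA]; exists m.
    by move=> w Ww; apply: mA => i im; rewrite cantor_addE Ww // addbF.
  move=> y yx; rewrite -(subrK x y) addrC; apply: mA => i im.
  by rewrite cantor_addE (yx i im) addbb.
(* Coordinate [n] no longer changes from [a n.+1] on, since [n < K n.+1]. *)
- move=> a K Kincr aK; exists (fun n => a n.+1 n) => i n nK.
  have Kge j : (j <= K j)%N by elim: j => // j /leq_ltn_trans; apply.
  have [ni|/ltnW ni] := leqP i n.+1; first exact: (aK i n.+1 ni n nK).
  by have := aK n.+1 i ni n (Kge _); rewrite !cantor_addE addbC.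
- move=> m; exists (fun i => i == m); first by move=> i /ltn_eqF.
  by exists m.+1 => /(_ m (leqnn _)); rewrite eqxx.
Qed.

Lemma finite_seq_dense (x : cantor_space) m : exists c, forall i, (i < m)%N ->
  ((fun n => nth false (odflt [::] (unpickle c)) n) - x : cantor_space) i = false.
Proof.
exists (pickle (mkseq x m)) => i im.
by rewrite pickleK cantor_addE /= nth_mkseq // addbb.
Qed.

Theorem mainTheorem1 (R : realType) :
  (forall F : set R, meagre F ->
     exists (x : R) (H : set R),
       [/\ is_subgroup H, dense H, ~ baire_property H
         & [set a + x | a in F] `&` H = set0]) /\
  (forall F : set cantor_space, meagre F ->
     exists (x : cantor_space) (H : set cantor_space),
       [/\ is_subgroup H, dense H, ~ baire_property H
         & [set a + x | a in F] `&` H = set0]).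
Proof.
split; first exact: (avoiding_subgroup (real_scale R) _ (@rat_seq_dense R)).
exact: (avoiding_subgroup cantor_scale _ finite_seq_dense).
Qed.
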